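(* Let $\vec P$ be a normalized behavior of $n\ge1$ parties. Partition the parties into $\mathrm A_1,\dots,\mathrm A_{n_{\mathsf Z}}$ and $\mathrm B_1,\dots,\mathrm B_{n_{\mathsf S}}$ with $n_{\mathsf Z}+n_{\mathsf S}=n$, with associated spaces $\mathcal{A}_1,\dots,\mathcal{A}_{n_{\mathsf Z}},\mathcal{B}_1,\dots,\mathcal{B}_{n_{\mathsf S}}$. (1) If $n_{\mathsf Z}=n$ and $n_{\mathsf S}=0$, then $(\tau_{\mathcal{A}_1}\otimes\tau_{\mathcal{A}_2}\otimes\dots\otimes\tau_{\mathcal{A}_n})\,\vec P=1$, and thus the component of $\vec P$ in $\mathsf{Z}_{\mathcal{A}_1}\otimes\dots\otimes\mathsf{Z}_{\mathcal{A}_n}$ equals $\vec Z_{\mathcal{A}_1}\otimes\dots\otimes\vec Z_{\mathcal{A}_n}$. (2) If $n_{\mathsf S}=n$ and $n_{\mathsf Z}=0$, then $(\overline{\sigma}_{\mathcal{B}_1}^{\,k_1}\otimes\dots\otimes\overline{\sigma}_{\mathcal{B}_{n}}^{\,k_{n}})\,\vec P=0$ for all $k_1,\dots,k_n$. (3) If $n_{\mathsf Z},n_{\mathsf S}>0$, then $(\tau_{\mathcal{A}_1}\otimes\dots\otimes\tau_{\mathcal{A}_{n_{\mathsf Z}}}\otimes\overline{\sigma}_{\mathcal{B}_1}^{\,k_1}\otimes\dots\otimes\overline{\sigma}_{\mathcal{B}_{n_{\mathsf S}}}^{\,k_{n_{\mathsf S}}})\,\vec P=0$ for all $k_1,\dots,k_{n_{\mathsf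 S}}$. In particular, when $n_{\mathsf S}>0$, $\vec P$ has no component in the subspace $\mathsf{Z}_{\mathcal{A}_1}\otimes\dots\otimes\mathsf{Z}_{\mathcal{A}_{n_{\mathsf Z}}}\otimes\mathsf{S}_{\mathcal{B}_1}\otimes\dots\otimes\mathsf{S}_{\mathcal{B}_{n_{\mathsf S}}}$.
   Context: Each party has a cardinality $\overline{A}=(A_1,\dots,A_X)$, a finite nonempty sequence of positive integers: inputs $x\in\{1,\dots,X\}$ and, for input $x$, outputs $a\in\{1,\dots,A_x\}$. Its space is $\mathcal{A}=\mathbb{R}^{\sum_x A_x}$ with standard basis $[a|x]$ and dual standard basis $[a|x]^*$. An $n$-party behavior is an element of the tensor product of the $n$ party spaces, with coordinates $P(\text{outputs}|\text{inputs})$; it is normalized if, for every choice of inputs, its coordinates sum to $1$ over all outputs. For a party with space $\mathcal{A}$ and cardinality $(A_1,\dots,A_X)$ define: $\vec Z_{\mathcal A}=\sum_{x}\sum_{a=1}^{A_x}\frac{1}{A_x}[a|x]$; $\vec C_{\mathcal A}^{\,i|x}=\frac{1}{A_x}([i|x]-[A_x|x])$ ($1\le x\le X$, $1\le i\le A_x-1$); $\vec S_{\mathcal A}^{\,k}=\sum_{a=1}^{A_k}\frac{X}{A_k}[a|k]-\vec Z_{\mathcal A}$ ($1\le k\le X-1$); $\mathsf{Z}_{\mathcal A}=\mathrm{span}(\vec Z_{\mathcal A})$, $\mathsf{C}_{\mathcal A}=\mathrm{span}\{\vec C_{\mathcal A}^{\,i|x}\}$, $\mathsf{S}_{\mathcal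 A}=\mathrm{span}\{\vec S_{\mathcal A}^{\,k}\}$, so that $\mathcal{A}=\mathsf{S}_{\mathcal A}\oplus\mathsf{C}_{\mathcal A}\oplus\mathsf{Z}_{\mathcal A}$; and the linear forms $\sigma_{\mathcal A}^x=\sum_{a=1}^{A_x}[a|x]^*$, $\tau_{\mathcal A}=\frac1X\sum_x\sigma_{\mathcal A}^x$, $\overline{\sigma}_{\mathcal A}^{\,k}=\frac1X(\sigma_{\mathcal A}^k-\sigma_{\mathcal A}^X)$ ($1\le k\le X-1$). Components of an $n$-party vector refer to the decomposition of the $n$-fold tensor product into the $3^n$ subspaces obtained by expanding $\bigotimes(\mathsf{S}\oplus\mathsf{C}\oplus\mathsf{Z})$. Tensor products of forms and vectors are understood with the factors in the order of the parties they act on. *)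

(* Defs.v *)
From HB Require Import structures.
From mathcomp Require Import all_boot all_order all_algebra.
From mathcomp Require Import reals.
Set Implicit Arguments.
Unset Strict Implicit.
Unset Printing Implicit Defensive.
Import GRing.Theory.
Local Open Scope ring_scope.

(* Inputs and outputs are numbered from 0: the input numbered x in 1..X is the
   ordinal of value x - 1, and likewise for outputs. *)
Record cardinality := Cardinality {
  ninputs : nat;
  noutputs : 'I_ninputs -> nat;
  ninputs_gt0 : (0 < ninputs)%N;
  noutputs_gt0 : forall x, (0 < noutputs x)%N }.

Fact ltn_pred_pos n (n_gt0 : (0 < n)%N) : (n.-1 < n)%N.
Proof. by rewrite ltn_predL. Qed.

Definition last_input (A : cardinality) : 'I_(ninputs A) :=
  Ordinal (ltn_pred_pos (ninputs_gt0 A)).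
Definition last_output (A : cardinality) (x : 'I_(ninputs A)) :
    'I_(noutputs x) :=
  Ordinal (ltn_pred_pos (noutputs_gt0 x)).

Definition outcome (A : cardinality) : finType :=
  {x : 'I_(ninputs A) & 'I_(noutputs x)}.

Definition mkoutcome (A : cardinality) (x : 'I_(ninputs A))
    (a : 'I_(noutputs x)) : outcome A :=
  Tagged (fun x : 'I_(ninputs A) => 'I_(noutputs x)) a.

Section StandardBasis.
Variables (R : realType) (I : finType) (i : I).

Definition basis_vec : {ffun I -> R^o} := [ffun j => (j == i)%:R].

Definition coordinate (v : {ffun I -> R^o}) : R^o := v i.

Fact coordinate_is_linear : linear coordinate.
Proof. by move=> c u w; rewrite /coordinate !ffunE. Qed.

HB.instance Definition _ :=
  GRing.isLinear.Build R {ffun I -> R^o} R^o *:%R coordinate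
    coordinate_is_linear.

Definition dual_vec : 'Hom({ffun I -> R^o}, R^o) := linfun coordinate.

Lemma dual_vecE v : dual_vec v = v i.
Proof. by rewrite lfunE. Qed.

End StandardBasis.

Notation party_space R A := {ffun outcome A -> R^o}.

Section Party.
Variables (R : realType) (A : cardinality).

Definition Zvec : party_space R A :=
  \sum_(x < ninputs A) \sum_(a < noutputs x)
    (noutputs x)%:R^-1 *: basis_vec R (mkoutcome a).

(* Defined for every output i of x; the range 1 <= i <= A_x - 1 is imposed in
   [Cspace], and similarly for [Svec] in [Sspace]. *)
Definition Cvec (x : 'I_(ninputs A)) (i : 'I_(noutputs x)) : party_space R A :=
  (noutputs x)%:R^-1 *:
    (basis_vec R (mkoutcome i) - basis_vec R (mkoutcome (last_output x))).

Definition Svec (k : 'I_(ninputs A)) : party_space R A :=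
  \sum_(a < noutputs k)
    ((ninputs A)%:R / (noutputs k)%:R) *: basis_vec R (mkoutcome a) - Zvec.

Definition Zspace : {vspace party_space R A} := <[Zvec]>%VS.

Definition Cspace : {vspace party_space R A} :=
  <<[seq Cvec (tagged j)
      | j in [pred j : outcome A | (tagged j).+1 < noutputs (tag j)]%N]>>%VS.

Definition Sspace : {vspace party_space R A} :=
  <<[seq Svec k
      | k in [pred k : 'I_(ninputs A) | k.+1 < ninputs A]%N]>>%VS.

Definition sigma (x : 'I_(ninputs A)) : 'Hom(party_space R A, R^o) :=
  \sum_(a < noutputs x) dual_vec R (mkoutcome a).

Definition tau : 'Hom(party_space R A, R^o) :=
  (ninputs A)%:R^-1 *: \sum_(x < ninputs A) sigma x.

Definition sigmabar (k : 'I_(ninputs A)) : 'Hom(party_space R A, R^o) :=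
  (ninputs A)%:R^-1 *: (sigma k - sigma (last_input A)).

End Party.

Variant part := partS | partC | partZ.

Definition ord_of_part (t : part) : 'I_3 :=
  match t with partS => inord 0 | partC => inord 1 | partZ => inord 2 end.
Definition part_of_ord (i : 'I_3) : part :=
  match val i with 0 => partS | 1 => partC | _ => partZ end.
Fact ord_of_partK : cancel ord_of_part part_of_ord.
Proof. by case; rewrite /part_of_ord /= inordK. Qed.

HB.instance Definition _ := Finite.copy part (can_type ord_of_partK).

Definition part_space (R : realType) (A : cardinality) (t : part) :
    {vspace party_space R A} :=
  match t with
  | partS => Sspace R A
  | partC => Cspace R A
  | partZ => Zspace R A
  end.

Section Behaviors.
Variables (R : realType) (n : nat) (A : 'I_n -> cardinality).

Definition joint_outcome : finType := {dffun forall p : 'I_n, outcome (A p)}.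

(* The tensor product of the party spaces, in coordinates with respect to the
   tensor products of the standard basis vectors. *)
Notation tensor_space := {ffun joint_outcome -> R^o}.

Definition normalized (P : tensor_space) : Prop :=
  forall x : (forall p : 'I_n, 'I_(ninputs (A p))),
    \sum_(i : joint_outcome | [forall p, tag (i p) == x p]) P i = 1.

Definition tensor_vec (v : forall p, party_space R (A p)) : tensor_space :=
  [ffun i : joint_outcome => \prod_(p < n) v p (i p)].

Definition tensor_form (f : forall p, 'Hom(party_space R (A p), R^o)) :
    'Hom(tensor_space, R^o) :=
  \sum_(i : joint_outcome)
    (\prod_(p < n) f p (basis_vec R (i p)) : R) *: dual_vec R i.

(* T belongs to the tensor product of the subspaces W p. *)
Definition in_tensor (W : forall p, {vspace party_space R (A p)})
    (T : tensor_space) : Prop :=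
  exists (m : nat) (v : 'I_m -> forall p, party_space R (A p)),
    (forall j p, v j p \in W p) /\ T = \sum_(j < m) tensor_vec (v j).

(* Q is the component of P labelled t in some decomposition of P along the
   3 ^ n subspaces. A statement of the form
   [forall Q, is_component P t Q <-> Q = Q0] asserts both that the component is
   well defined and that it is Q0. *)
Definition is_component (P : tensor_space) (t : {ffun 'I_n -> part})
    (Q : tensor_space) : Prop :=
  exists D : {ffun 'I_n -> part} -> tensor_space,
    [/\ forall s : {ffun 'I_n -> part},
          in_tensor (fun p => part_space R (A p) (s p)) (D s),
        P = \sum_s D s
      & Q = D t].

End Behaviors.

Notation tensor_space R A := {ffun joint_outcome A -> R^o}.

(* Main.v *)
(* The standard-basis matrix of each of the three projections S, C, Z of a party
   space is explicit, so the component of P labelled t is obtained by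
   contracting P with the product of the matrices of the t p. The matrices of Z
   and S, like the forms tau and sigmabar, depend on an outcome only through its
   input. Contracting a normalized P with such a product sums its outputs to 1,
   and what remains factorizes into one sum over the inputs for each party: this
   sum is 1 for tau, the coordinate of Zvec for Z, and 0 for sigmabar and S. *)
Require Import Defs.
From mathcomp Require Import all_boot all_order all_algebra.
From mathcomp Require Import reals.
From mathcomp Require Import ring.
Set Implicit Arguments.
Unset Strict Implicit.
Unset Printing Implicit Defensive.
Import GRing.Theory.
Local Open Scope ring_scope.

(** Distributivity with codomains that vary with the index: a dependent function is transported to
    [fprod], that is, to functions into the tagged union, where the non-dependent law applies. *)
Lemma prod_sum_dffun (R : comNzRingType) (I : finType) (T : I -> finType)
    (F : forall i, T i -> R) :
  \prod_i \sum_(x : T i) F i x =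
  \sum_(f : {dffun forall i, T i}) \prod_i F i (f i).
Proof.
rewrite (reindex (@dffun_of_fprod _ T)); last first.
  exact/onW_bij/dffun_of_fprod_bij.
transitivity (\sum_(t : fprod T) \prod_i [ffun x => F i x] (t i)); last first.
  by apply: eq_bigr => t _; apply: eq_bigr => i _; rewrite !ffunE.
(* The default 0 of [untag] is for elements with a foreign tag; the restriction to [tagged_with T]
   excludes them. *)
rewrite big_fprod -(bigA_distr_big_dep (tagged_with T)
  (fun i => untag 0 [ffun x => F i x])).
apply: eq_bigr => i _; rewrite -(big_tag (fun i => [ffun x => F i x])).
by apply: eq_bigr => x _; rewrite ffunE.
Qed.

(** * One party: coordinates, forms and the three projections *)

Section Party.
Variables (R : realType) (A : cardinality).
Implicit Types (v : party_space R A) (x k : 'I_(ninputs A)) (i j : outcome A).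

Lemma sum_outcome (F : outcome A -> R) :
  \sum_j F j = \sum_x \sum_a F (@mkoutcome A x a).
Proof.
rewrite (sig_big_dep xpredT (fun _ => xpredT) (fun x a => F (@mkoutcome A x a))).
by apply: eq_bigr => -[].
Qed.

Lemma sum_outcome_at x (F : outcome A -> R) :
  \sum_(j | tag j == x) F j = \sum_a F (@mkoutcome A x a).
Proof.
rewrite -(big_pred1_eq +%R x (fun y => \sum_a F (@mkoutcome A y a))).
rewrite (sig_big_dep (pred1 x) (fun _ => xpredT) (fun x a => F (@mkoutcome A x a))).
by apply: eq_big => -[] //= y a; rewrite andbT.
Qed.

Lemma sigmaE x v : sigma R x v = \sum_(j | tag j == x) v j.
Proof.
rewrite sum_outcome_at sum_lfunE; apply: eq_bigr => a _; exact: dual_vecE.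
Qed.

Lemma tauE v : tau R A v = (ninputs A)%:R^-1 * \sum_j v j.
Proof.
rewrite /tau scale_lfunE sum_lfunE sum_outcome; congr (_ * _).
by apply: eq_bigr => x _; rewrite sigmaE sum_outcome_at.
Qed.

Lemma tau_sigma v : tau R A v = (ninputs A)%:R^-1 * \sum_x sigma R x v.
Proof. by rewrite /tau scale_lfunE sum_lfunE. Qed.

Lemma ninputs_neq0 : (ninputs A)%:R != 0 :> R.
Proof. by rewrite Num.Theory.pnatr_eq0 -lt0n ninputs_gt0. Qed.

Lemma noutputs_neq0 x : (noutputs x)%:R != 0 :> R.
Proof. by rewrite Num.Theory.pnatr_eq0 -lt0n noutputs_gt0. Qed.

Lemma ZvecE j : Zvec R A j = (noutputs (tag j))%:R^-1.
Proof.
rewrite /Zvec sum_ffunE.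
under eq_bigr do rewrite sum_ffunE.
rewrite -(sum_outcome (fun i =>
  ((noutputs (tag i))%:R^-1 *: basis_vec R (mkoutcome (tagged i))) j)).
rewrite (bigD1 j) //= big1 => [|i ij]; rewrite !ffunE /= /mkoutcome taggedK.
  by rewrite eqxx addr0 /GRing.scale /= mulr1.
by rewrite [_ == i]eq_sym (negbTE ij) scaler0.
Qed.

Lemma SvecE k j :
  Svec R k j =
  ((tag j == k)%:R * (ninputs A)%:R - 1) / (noutputs (tag j))%:R.
Proof.
rewrite /Svec !ffunE ZvecE sum_ffunE mulrBl mul1r; congr (_ - _).
pose F i : R := ((ninputs A)%:R / (noutputs (tag i))%:R *: basis_vec R i) j.
rewrite -(sum_outcome_at k F) big_mkcond (bigD1 j) //= big1 => [|i ij].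
  by rewrite addr0 /F !ffunE eqxx /GRing.scale /= mulr1; case: eqP => _;
    rewrite ?mul1r ?mul0r.
by rewrite /F !ffunE [_ == i]eq_sym (negbTE ij) scaler0 if_same.
Qed.

Lemma sigma_basis x j : sigma R x (basis_vec R j) = (tag j == x)%:R.
Proof.
rewrite sigmaE big_mkcond (bigD1 j) //= big1 => [|i ij].
  by rewrite addr0 ffunE eqxx; case: eqP.
by rewrite ffunE (negbTE ij) if_same.
Qed.

Lemma sigma_const x v (c : R) :
  (forall j, tag j = x -> v j = c / (noutputs x)%:R) -> sigma R x v = c.
Proof.
move=> vE; rewrite sigmaE (eq_bigr (fun _ : outcome A => c / (noutputs x)%:R)).
  rewrite sum_outcome_at sumr_const card_ord -[LHS]mulr_natr.
  by rewrite divfK ?noutputs_neq0.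
by move=> j /eqP/vE.
Qed.

Lemma sigma_Zvec x : sigma R x (Zvec R A) = 1.
Proof. by apply: sigma_const => j <-; rewrite ZvecE mul1r. Qed.

Lemma sigma_Svec x k : sigma R x (Svec R k) = (x == k)%:R * (ninputs A)%:R - 1.
Proof. by apply: sigma_const => j <-; rewrite SvecE. Qed.

Lemma sigma_Cvec x k (a : 'I_(noutputs k)) : sigma R x (Cvec R a) = 0.
Proof.
by rewrite /Cvec linearZ /= linearB /= !sigma_basis subrr scaler0.
Qed.

Lemma tau_Svec k : tau R A (Svec R k) = 0.
Proof.
rewrite tau_sigma; under eq_bigr do rewrite sigma_Svec.
rewrite big_split /= -mulr_suml sumr_const card_ord mulNrn.
rewrite (bigD1 k) //= eqxx big1 => [|x /negbTE->//].
by rewrite addr0 mul1r addrN mulr0.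
Qed.

(** Since [tau] is 1 on [Zvec], it reads off the coefficient of a multiple of [Zvec]. *)
Lemma Zspace_coord v j :
  v \in Zspace R A -> v j = tau R A v / (noutputs (tag j))%:R.
Proof.
case/vlineP => c ->; rewrite linearZ /= tau_sigma ffunE ZvecE.
under eq_bigr do rewrite sigma_Zvec.
by rewrite sumr_const card_ord mulVf ?ninputs_neq0 // /GRing.scale /= mulr1.
Qed.

Lemma Zspace_sigma v x : v \in Zspace R A -> sigma R x v = tau R A v.
Proof.
by move=> vZ; apply: sigma_const => j <-; apply: Zspace_coord.
Qed.

Lemma Sspace_tau v : v \in Sspace R A -> tau R A v = 0.
Proof.
have /subvP sub : (Sspace R A <= lker (tau R A))%VS.
  apply/span_subvP => _ /mapP[k _ ->]; rewrite memv_ker; apply/eqP.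
  exact: tau_Svec.
by move/sub; rewrite memv_ker => /eqP.
Qed.

(** Every [Svec] is constant over the outputs of each input. The form [f] measures the deviation
    from the average at [j]; it vanishes on the generators, hence on their span. *)
Lemma Sspace_coord v j :
  v \in Sspace R A -> v j = sigma R (tag j) v / (noutputs (tag j))%:R.
Proof.
pose f := dual_vec R j - (noutputs (tag j))%:R^-1 *: sigma R (tag j).
have fE w : f w = w j - sigma R (tag j) w / (noutputs (tag j))%:R.
  by rewrite add_lfunE opp_lfunE scale_lfunE dual_vecE [in RHS]mulrC.
have /subvP sub : (Sspace R A <= lker f)%VS.
  apply/span_subvP => _ /mapP[k _ ->]; rewrite memv_ker fE.
  by rewrite SvecE sigma_Svec subrr.
by move/sub; rewrite memv_ker fE subr_eq0 => /eqP.
Qed.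

Lemma Cspace_sigma v x : v \in Cspace R A -> sigma R x v = 0.
Proof.
have /subvP sub : (Cspace R A <= lker (sigma R x))%VS.
  apply/span_subvP => _ /mapP[k _ ->]; rewrite memv_ker; apply/eqP.
  exact: sigma_Cvec.
by move/sub; rewrite memv_ker => /eqP.
Qed.

Lemma Cspace_tau v : v \in Cspace R A -> tau R A v = 0.
Proof.
by move=> vC; rewrite tau_sigma big1 ?mulr0 // => x _; apply: Cspace_sigma.
Qed.

(** The generators of [Sspace] omit the last input. All the [Svec] add up to 0, so the one at the
    last input is minus the sum of the others. *)
Lemma Svec_in_Sspace k : Svec R k \in Sspace R A.
Proof.
have inS x : (x.+1 < ninputs A)%N -> Svec R x \in Sspace R A.
  by move=> x_lt; apply/memv_span/imageP; exists x.
have [/inS//|k_last] := boolP (k.+1 < ninputs A)%N.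
have : \sum_x Svec R x = 0 :> party_space R A.
  apply/ffunP => j; rewrite sum_ffunE ffunE.
  under eq_bigr do rewrite SvecE.
  rewrite -mulr_suml big_split /= -mulr_suml sumr_const card_ord mulNrn.
  rewrite (bigD1 (tag j)) //= eqxx big1 => [|x /negbTE]; last first.
    by rewrite eq_sym => ->.
  by rewrite addr0 mul1r addrN mul0r.
rewrite (bigD1 k) //= => /eqP; rewrite addr_eq0 => /eqP ->.
rewrite memvN; apply: memv_suml => x x_neq; apply: inS.
(* An input outside the range of the generators has the largest possible value, as [k] does, so it
   is [k]. *)
rewrite ltnNge; apply: contra x_neq => x_ge.
apply/eqP/val_inj => /=; move: (ltn_ord x) (ltn_ord k) => lx lk.
apply/eqP; rewrite -eqSS; apply/eqP.
transitivity (ninputs A); apply/eqP; rewrite eqn_leq.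
  by rewrite lx x_ge.
by rewrite lk leqNgt k_last.
Qed.

(** At the last output, which the generators omit, [Cvec] is a difference of equal vectors. *)
Lemma Cvec_in_Cspace x (a : 'I_(noutputs x)) : Cvec R a \in Cspace R A.
Proof.
have [a_lt|a_last] := boolP (a.+1 < noutputs x)%N.
  by apply/memv_span/imageP; exists (mkoutcome a).
suff -> : a = last_output x by rewrite /Cvec subrr scaler0 mem0v.
apply/val_inj => /=; apply/eqP; rewrite -eqSS prednK ?noutputs_gt0 //.
by rewrite eqn_leq ltn_ord leqNgt a_last.
Qed.

(* The matrix of the projection onto [part_space A t] along the two other
   summands. *)
Definition part_kernel (t : part) i j : R :=
  match t with
  | partS => ((tag i == tag j)%:R - (ninputs A)%:R^-1) / (noutputs (tag i))%:R
  | partC => (i == j)%:R - (tag i == tag j)%:R / (noutputs (tag i))%:R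
  | partZ => (ninputs A)%:R^-1 / (noutputs (tag i))%:R
  end.

Lemma part_kernel_sum i j : \sum_t part_kernel t i j = (i == j)%:R.
Proof.
have -> : \sum_t part_kernel t i j = 
    part_kernel partS i j + part_kernel partC i j + part_kernel partZ i j.
  rewrite (bigD1 partS) //= (bigD1 partC) /=; last exact/eqP.
  rewrite (bigD1 partZ) /=; last by apply/andP; split; apply/eqP.
  by rewrite big1 ?addr0 ?addrA // => -[]; rewrite eqxx ?andbF.
by rewrite /= mulrBl; ring.
Qed.

Lemma part_kernel_col t j :
  [ffun i => part_kernel t i j] \in part_space R A t.
Proof.
(* These are the projections of the basis vector at [j]. For [partC] it is that vector minus the
   average over the outputs of its input; the contributions of the last output cancel. *)
have -> : [ffun i => part_kernel t i j] =
  match t return party_space R A with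
  | partS => (ninputs A)%:R^-1 *: Svec R (tag j)
  | partC => (noutputs (tag j))%:R *: Cvec R (tagged j)
             - \sum_(a < noutputs (tag j)) Cvec R a
  | partZ => (ninputs A)%:R^-1 *: Zvec R A
  end.
  apply/ffunP => i; rewrite ffunE; case: t => /=.
  - rewrite ffunE SvecE /GRing.scale /=.
    by field; rewrite ninputs_neq0 noutputs_neq0.
  - rewrite !ffunE sum_ffunE; under eq_bigr do rewrite !ffunE.
    rewrite -scaler_sumr big_split /= sumr_const card_ord.
    pose F j' : R := (i == j')%:R.
    rewrite -(sum_outcome_at _ F) big_mkcond (bigD1 i) //= big1 => [|l li].
      rewrite /F eqxx addr0 /mkoutcome taggedK /GRing.scale /=.
      rewrite -[_ *- _ *+ _]mulr_natr.
      have [->|_] /= := eqVneq (tag i) (tag j).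
        by field; rewrite noutputs_neq0.
      by field; rewrite !noutputs_neq0.
    by rewrite /F [i == l]eq_sym (negbTE li) if_same.
  - by rewrite ffunE ZvecE.
case: t.
- apply: memvZ; exact: Svec_in_Sspace.
- apply: memvB; first by apply: memvZ; exact: Cvec_in_Cspace.
  by apply: memv_suml => a _; exact: Cvec_in_Cspace.
- apply: memvZ; exact: memv_line.
Qed.

Lemma sum_tag_sigma i v :
  \sum_j (tag i == tag j)%:R * v j = sigma R (tag i) v.
Proof.
rewrite sigmaE [RHS]big_mkcond; apply: eq_bigr => j _.
by rewrite eq_sym; case: eqP; rewrite ?mul1r ?mul0r.
Qed.

(** Each matrix is the identity on its own summand and 0 on the other two, which makes the
    decomposition unique. *)
Lemma part_kernel_row s t i v : v \in part_space R A s ->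
  \sum_j part_kernel t i j * v j = (s == t)%:R * v i.
Proof.
(* Once the action is written with [sigma] and [tau], three facts settle all cases: [tau] kills S,
   every [sigma] kills C, and each [sigma] equals [tau] on Z. *)
have -> : \sum_j part_kernel t i j * v j =
  match t with
  | partS => (sigma R (tag i) v - tau R A v) / (noutputs (tag i))%:R
  | partC => v i - sigma R (tag i) v / (noutputs (tag i))%:R
  | partZ => tau R A v / (noutputs (tag i))%:R
  end.
  rewrite tauE -sum_tag_sigma; case: t => /=.
  - rewrite mulr_sumr -sumrB mulr_suml; apply: eq_bigr => j _; ring.
  - have -> : v i = \sum_j (i == j)%:R * v j.
      rewrite (bigD1 i) //= eqxx big1 ?addr0 ?mul1r // => j /negbTE.
      by rewrite eq_sym => ->; rewrite mul0r.
    rewrite mulr_suml -sumrB; apply: eq_bigr => j _; ring.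
  - rewrite mulr_sumr mulr_suml; apply: eq_bigr => j _; ring.
have [<- | st] := eqVneq s t; rewrite ?mul1r ?mul0r.
  case: s => v_in.
  - by rewrite [RHS]Sspace_coord // Sspace_tau // subr0.
  - by rewrite Cspace_sigma // mul0r subr0.
  - by rewrite [RHS]Zspace_coord.
case: s t st => -[]; rewrite ?eqxx // => _ v_in.
- by rewrite [v i]Sspace_coord // subrr.
- by rewrite Sspace_tau // mul0r.
- by rewrite Cspace_sigma // Cspace_tau // subrr mul0r.
- by rewrite Cspace_tau // mul0r.
- by rewrite Zspace_sigma // subrr mul0r.
- by rewrite [v i]Zspace_coord // Zspace_sigma // subrr.
Qed.

End Party.

Lemma sum_part_kernelS (R : realType) (A : cardinality) (i : outcome A) :
  \sum_x ((tag i == x)%:R - (ninputs A)%:R^-1) / (noutputs (tag i))%:R = 0 :> R.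
Proof.
rewrite -mulr_suml sumrB sumr_const card_ord.
rewrite (bigD1 (tag i)) //= eqxx big1 => [|x /negbTE]; last first.
  by rewrite eq_sym => ->.
by rewrite -[_ *+ ninputs A]mulr_natr mulVf ?ninputs_neq0 // addr0 subrr mul0r.
Qed.

(** * Several parties: components and contractions of normalized behaviors *)

Section Tensor.
Variables (R : realType) (n : nat) (A : 'I_n -> cardinality).
Implicit Types (T P Q : tensor_space R A) (s t : {ffun 'I_n -> part}).

Definition tensor_proj t T : tensor_space R A :=
  [ffun i : joint_outcome A =>
    \sum_(j : joint_outcome A)
      (\prod_p part_kernel R (t p) (i p) (j p)) * T j].

(** There is one pure tensor of matrix columns per joint outcome. Its scalar coefficient is absorbed
    by the factor of the party [p0], which exists because [n] is positive. *)
Lemma in_tensor_proj (n_gt0 : (0 < n)%N) t T :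
  in_tensor (fun p => part_space R (A p) (t p)) (tensor_proj t T).
Proof.
pose p0 := Ordinal n_gt0.
exists #|joint_outcome A|, (fun l p =>
  (if p == p0 then T (enum_val l) else 1) *:
    ([ffun i => part_kernel R (t p) i (enum_val l p)]
      : party_space R (A p))); split.
  by move=> l p; rewrite memvZ // part_kernel_col.
apply/ffunP => i; rewrite sum_ffunE ffunE.
rewrite (big_enum_val (A := joint_outcome A)
  (fun j => (\prod_p part_kernel R (t p) (i p) (j p)) * T j)) /=.
apply: eq_bigr => l _; rewrite ffunE.
under [RHS]eq_bigr do rewrite !ffunE.
rewrite big_split /= mulrC; congr (_ * _).
by rewrite (bigD1 p0) //= big1 ?mulr1 // => p /negbTE->.
Qed.

(** Summing over all labels factorizes over the parties, and the three matrices of each party add up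
    to the identity. *)
Lemma sum_tensor_proj T : \sum_t tensor_proj t T = T.
Proof.
apply/ffunP => i; rewrite sum_ffunE.
under eq_bigr do rewrite ffunE.
have sum_kernel (j : joint_outcome A) :
    \sum_(t : {ffun 'I_n -> part}) \prod_p part_kernel R (t p) (i p) (j p) =
    \prod_p (i p == j p)%:R.
  rewrite -(bigA_distr_bigA (fun p u => part_kernel R u (i p) (j p))).
  by apply: eq_bigr => p _; exact: part_kernel_sum.
rewrite exchange_big /=.
under eq_bigr => j _ do rewrite -mulr_suml sum_kernel.
rewrite (bigD1 i) //= big1 => [|p _]; last by rewrite eqxx.
rewrite mul1r big1 ?addr0 // => j ji.
have /existsP[p ijp] : [exists p, i p != j p].
  rewrite -negb_forall; apply: contra ji => /forallP ij.
  by rewrite eq_sym; apply/eqP/ffunP => p; apply/eqP.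
by rewrite (bigD1 p) //= (negbTE ijp) !mul0r.
Qed.

(** The projection acts factor by factor on pure tensors; a party where [s] and [t] differ
    contributes a factor 0. *)
Lemma tensor_proj_in_tensor s t T :
  in_tensor (fun p => part_space R (A p) (s p)) T ->
  tensor_proj t T = if s == t then T else 0.
Proof.
case=> m [v [v_in ->]]; apply/ffunP => i; rewrite ffunE.
have -> : \sum_(j : joint_outcome A)
      (\prod_p part_kernel R (t p) (i p) (j p)) *
    (\sum_(l < m) tensor_vec (v l)) j =
    \sum_(l < m) \prod_p ((s p == t p)%:R * v l p (i p)).
  under eq_bigr do rewrite sum_ffunE mulr_sumr.
  rewrite exchange_big; apply: eq_bigr => l _ /=.
  under [RHS]eq_bigr do rewrite -(part_kernel_row _ _ (v_in l _)).
  rewrite prod_sum_dffun; apply: eq_bigr => j _.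
  by rewrite ffunE -big_split.
under eq_bigr do rewrite big_split /=.
rewrite -mulr_sumr; have [->|st] := eqVneq s t.
  rewrite big1 ?mul1r => [|p _]; last by rewrite eqxx.
  by rewrite sum_ffunE; apply: eq_bigr => l _; rewrite ffunE.
have /existsP[p stp] : [exists p, s p != t p].
  rewrite -negb_forall; apply: contra st => /forallP st.
  by apply/eqP/ffunP => p; apply/eqP.
by rewrite (bigD1 p) //= (negbTE stp) !mul0r ffunE.
Qed.

(** The projections themselves give a decomposition; conversely, projecting any decomposition keeps
    only its term labelled [t]. *)
Lemma is_componentE (n_gt0 : (0 < n)%N) P t Q :
  is_component P t Q <-> Q = tensor_proj t P.
Proof.
split=> [[D [D_in -> ->]]|->]; last first.
  exists (fun s => tensor_proj s P); split=> // [s|].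
    exact: in_tensor_proj.
  by rewrite sum_tensor_proj.
have -> : tensor_proj t (\sum_s D s) = \sum_s tensor_proj t (D s).
  apply/ffunP => i; rewrite sum_ffunE ffunE.
  under [RHS]eq_bigr do rewrite ffunE.
  by rewrite exchange_big; apply: eq_bigr => j _; rewrite sum_ffunE mulr_sumr.
rewrite (eq_bigr _ (fun s _ => tensor_proj_in_tensor t (D_in s))).
by rewrite -big_mkcond big_pred1_eq.
Qed.

(* For a normalized behavior the sums over the outputs disappear, so that the
   sum over the inputs factorizes over the parties. *)
Lemma normalized_sum P (g : forall p, 'I_(ninputs (A p)) -> R) :
  normalized P ->
  \sum_(j : joint_outcome A) (\prod_p g p (tag (j p))) * P j =
  \prod_p \sum_x g p x.
Proof.
move=> P_normalized; rewrite prod_sum_dffun.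
pose inputs (j : joint_outcome A) : {dffun forall p, 'I_(ninputs (A p))} :=
  [ffun p => tag (j p)].
rewrite (partition_big inputs xpredT) //=; apply: eq_bigr => x _.
rewrite -[RHS]mulr1 -(P_normalized x) mulr_sumr; apply: eq_big => j.
  by apply/eqP/forallP => [<- p|jx]; [rewrite ffunE|
    apply/ffunP => p; rewrite ffunE; apply/eqP].
by move=> /eqP <-; congr (_ * _); apply: eq_bigr => p _; rewrite ffunE.
Qed.

Lemma tensor_formE (f : forall p, 'Hom(party_space R (A p), R^o)) P :
  tensor_form f P =
  \sum_(j : joint_outcome A) (\prod_p f p (basis_vec R (j p))) * P j.
Proof.
rewrite /tensor_form sum_lfunE; apply: eq_bigr => j _.
by rewrite scale_lfunE dual_vecE.
Qed.

Lemma tensor_form_normalized P (f : forall p, 'Hom(party_space R (A p), R^o))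
    (g : forall p, 'I_(ninputs (A p)) -> R) :
  normalized P -> (forall p j, f p (basis_vec R j) = g p (tag j)) ->
  tensor_form f P = \prod_p \sum_x g p x.
Proof.
move=> P_normalized fg; rewrite tensor_formE -(normalized_sum _ P_normalized).
apply: eq_bigr => j _; congr (_ * _); exact: eq_bigr.
Qed.

End Tensor.

(** * Values of the forms on basis vectors and their sums over inputs *)

Lemma tau_basis (R : realType) (A : cardinality) (j : outcome A) :
  tau R A (basis_vec R j) = (ninputs A)%:R^-1.
Proof.
rewrite tau_sigma (bigD1 (tag j)) //= big1 => [|x jx].
  by rewrite sigma_basis eqxx addr0 mulr1.
by rewrite sigma_basis eq_sym (negbTE jx).
Qed.

Lemma sigmabar_basis (R : realType) (A : cardinality) (k : 'I_(ninputs A))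
    (j : outcome A) :
  sigmabar R k (basis_vec R j) =
  (ninputs A)%:R^-1 * ((tag j == k)%:R - (tag j == last_input A)%:R).
Proof. by rewrite /sigmabar scale_lfunE add_lfunE opp_lfunE !sigma_basis. Qed.

Lemma sum_tau (R : realType) (A : cardinality) :
  \sum_(x < ninputs A) (ninputs A)%:R^-1 = 1 :> R.
Proof. by rewrite sumr_const card_ord -[LHS]mulr_natr mulVf ?ninputs_neq0. Qed.

Lemma sum_sigmabar (R : realType) (A : cardinality) (k : 'I_(ninputs A)) :
  \sum_x (ninputs A)%:R^-1 * ((x == k)%:R - (x == last_input A)%:R) = 0 :> R.
Proof.
have sum1 (y : 'I_(ninputs A)) : \sum_x (x == y)%:R = 1 :> R.
  by rewrite (bigD1 y) //= eqxx big1 ?addr0 // => x /negbTE->.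
by rewrite -mulr_sumr sumrB !sum1 subrr mulr0.
Qed.

(** The contraction is a product over the parties, and a single party of [B] already contributes the
    factor 0. Taking [B] full gives the case with [sigmabar] only. *)
Lemma tensor_form_tau_sigmabar (R : realType) (n : nat)
    (A : 'I_n -> cardinality) (P : tensor_space R A) (B : {set 'I_n})
    (k : forall p, 'I_(ninputs (A p))) :
  normalized P -> (0 < #|B|)%N ->
  tensor_form (fun p => if p \in B then sigmabar R (k p) else tau R (A p)) P
  = 0.
Proof.
move=> P_normalized /card_gt0P[p pB].
rewrite (tensor_form_normalized (g := fun p x =>
  if p \in B then (ninputs (A p))%:R^-1 *
                    ((x == k p)%:R - (x == last_input (A p))%:R)
  else (ninputs (A p))%:R^-1)) //; last first.
  by move=> q j; case: ifP => _; [apply: sigmabar_basis|apply: tau_basis].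
by rewrite (bigD1 p) //= pB sum_sigmabar mul0r.
Qed.

Theorem proposition11 (R : realType) (n : nat) (n_ge1 : (1 <= n)%N)
    (card : 'I_n -> cardinality) (P : tensor_space R card)
    (P_normalized : normalized P)
    (A B : {set 'I_n}) (AB_cover : A :|: B = [set: 'I_n])
    (AB_disjoint : [disjoint A & B]) :
  [/\ (* (1) *)
      #|A| = n /\ #|B| = 0%N ->
        tensor_form (fun p => tau R (card p)) P = 1 /\
        (forall Q : tensor_space R card,
           is_component P [ffun _ => partZ] Q <->
           Q = tensor_vec (fun p => Zvec R (card p))),
      (* (2) *)
      #|B| = n /\ #|A| = 0%N ->
        forall k : (forall p : 'I_n, 'I_(ninputs (card p))),
          (forall p, ((k p).+1 < ninputs (card p))%N) ->
          tensor_form (fun p => sigmabar R (k p)) P = 0,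
      (* (3) *)
      (0 < #|A|)%N /\ (0 < #|B|)%N ->
        forall k : (forall p : 'I_n, 'I_(ninputs (card p))),
          (forall p, p \in B -> ((k p).+1 < ninputs (card p))%N) ->
          tensor_form (fun p => if p \in B then sigmabar R (k p)
                                else tau R (card p)) P = 0
    & (0 < #|B|)%N ->
        forall Q : tensor_space R card,
          is_component P [ffun p => if p \in B then partS else partZ] Q <->
          Q = 0].

Proof.
split.
- case=> _ B0; split.
    rewrite (tensor_form_normalized (g := fun p _ => (ninputs (card p))%:R^-1)) //.
      by rewrite big1 // => p _; apply: sum_tau.
    by move=> p j; apply: tau_basis.
  move=> Q; rewrite is_componentE //.
  suff -> : tensor_proj [ffun=> partZ] P = tensor_vec (fun p => Zvec R (card p)).
    by [].
  apply/ffunP => i; rewrite !ffunE.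
  under eq_bigr do under eq_bigr do rewrite ffunE /=.
  (* An entry of the Z matrix depends only on its row, so the weight is constant in the input. *)
  rewrite (normalized_sum (fun p _ =>
    (ninputs (card p))%:R^-1 / (noutputs (tag (i p)))%:R)) //.
  by apply: eq_bigr => p _; rewrite -mulr_suml sum_tau mul1r ZvecE.
- case=> Bn _ k _.
  have B_full p : p \in B.
    suff -> : B = setT by rewrite inE.
    by apply/eqP; rewrite eqEcard subsetT cardsT card_ord Bn leqnn.
  rewrite -[RHS](tensor_form_tau_sigmabar k P_normalized (B := B)) ?Bn //.
  by rewrite !tensor_formE; apply: eq_bigr => j _; congr (_ * _);
    apply: eq_bigr => p _; rewrite B_full.
- by case=> _ B_gt0 k _; apply: tensor_form_tau_sigmabar.
- case/card_gt0P=> p pB Q; rewrite is_componentE //.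
  suff -> : tensor_proj [ffun p => if p \in B then partS else partZ] P = 0.
    by [].
  apply/ffunP => i; rewrite !ffunE.
  (* Entries of the S and Z matrices see the column only through its input, so any output of [x] may
     represent it; the output numbered 0 always exists. *)
  pose g q x : R := part_kernel R (if q \in B then partS else partZ) (i q)
    (mkoutcome (Ordinal (noutputs_gt0 x))).
  transitivity (\prod_q \sum_x g q x).
    rewrite -(normalized_sum _ P_normalized); apply: eq_bigr => j _.
    congr (_ * _); apply: eq_bigr => q _.
    by rewrite /g ffunE; case: ifP.
  by rewrite (bigD1 p) //= /g pB sum_part_kernelS mul0r.
Qed.
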